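(* Let $(\mathcal X,\rho)$ be a complete separable metric space, let $f_1,\dots,f_m:\mathcal X\to\mathcal X$ be Lipschitz maps, and let $(\mu_k)_{k\ge 0}$ be a sequence of probability measures on $\{1,\dots,m\}$. Suppose that for each $k$ the operator $P_k$ has the weak Feller property. Let $k\ge 0$. If there exists $x\in\mathcal X$ for which the sequence of transition probability measures $\{\nu_k^N(x,\cdot)\}_{N\ge 0}$ is uniformly tight, then there exists an invariant probability measure for $P_k^*$, i.e. a Borel probability measure $\nu_k^*$ on $\mathcal X$ with $P_k^*\nu_k^*=\nu_k^*$.
   Context: For each $k$, $P_k$ acts on functions $f:\mathcal X\to\mathbb R$ by $(P_kf)(x)=\sum_{j=1}^m\mu_k(j)\,f(f_j(x))$. The weak Feller property means that $P_k$ maps bounded continuous functions $\mathcal X\to\mathbb R$ to bounded continuous functions. The dual operator acts on finite positive Borel measures by $(P_k^*\nu)(A)=\sum_{j=1}^m\mu_k(j)\,\nu(f_j^{-1}(A))$ for Borel sets $A$. For fixed $k$, consider the Markov chain $X_k^i=f_{\sigma_k^i}(X_k^{i-1})$, $i\ge1$, where $\sigma_k^1,\sigma_k^2,\dots$ are i.i.d. with law $\mu_k$ on $\{1,\dots,m\}$. For $N\ge 0$, $x\in\mathcal X$ and Borel $A$, $\nu_k^N(x,A)=\mathbb P(X_k^N\in A\mid X_k^0=x)$. A set $\mathcal M$ of Borel probability measures on $\mathcal X$ is uniformly tight if for every $\epsilon>0$ there is a compact $\mathcal K\subseteq\mathcal X$ with $\nu(\mathcal K)\ge 1-\epsilon$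 for all $\nu\in\mathcal M$. *)

(* Defs.v *)
From HB Require Import structures.
From mathcomp Require Import all_boot all_order all_algebra finmap.
From mathcomp Require Import all_classical all_reals all_analysis.

Set Implicit Arguments.
Unset Strict Implicit.
Unset Printing Implicit Defensive.

Import Order.TTheory GRing.Theory Num.Theory.
Import numFieldNormedType.Exports.

Local Open Scope classical_set_scope.
Local Open Scope ring_scope.

(* [Complete] carries a base point, which the library also requires of every
   measurableType. *)
#[short(type="completeMetricType")]
HB.structure Definition CompleteMetric (R : numDomainType) :=
  {T of Metric R T & Complete T}.

Definition separable (T : topologicalType) : Prop :=
  exists2 D : set T, countable D & dense D.

Notation borel T := (g_sigma_algebraType (@open T)).

(* The library's [lipschitz] is restricted to normed modules. *)
Definition metric_lipschitz (R : realType) (X Y : metricType R) (f : X -> Y)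
    : Prop :=
  exists2 L : R, 0 <= L & forall x y, mdist (f x) (f y) <= L * mdist x y.

Definition is_pmf (R : realType) (m : nat) (q : 'I_m -> R) : Prop :=
  (forall j, 0 <= q j) /\ \sum_(j < m) q j = 1.

Definition markov_op (R : realType) (X : Type) (m : nat) (f : 'I_m -> X -> X)
    (q : 'I_m -> R) (g : X -> R) : X -> R :=
  fun x => \sum_(j < m) q j * g (f j x).

Definition weak_feller (R : realType) (X : topologicalType)
    (P : (X -> R) -> (X -> R)) : Prop :=
  forall g : X -> R, continuous g -> bounded_fun g ->
    continuous (P g) /\ bounded_fun (P g).

Definition markov_dual (R : realType) (X : ptopologicalType) (m : nat)
    (f : 'I_m -> X -> X) (q : 'I_m -> R)
    (nu : {finite_measure set (borel X) -> \bar R}) (A : set (borel X))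
    : \bar R :=
  (\sum_(j < m) (q j)%:E * nu (f j @^-1` A))%E.

Definition iid_with_law (R : realType) (d : measure_display)
    (Omega : measurableType d) (Pr : probability Omega R) (m : nat)
    (q : 'I_m -> R) (sigma : nat -> Omega -> 'I_m) : Prop :=
  [/\ forall i (A : set 'I_m), measurable (sigma i @^-1` A),
      forall i j, Pr (sigma i @^-1` [set j]) = (q j)%:E &
      forall (J : {fset nat}) (A : nat -> set 'I_m),
        Pr (\bigcap_(i in [set` J]) (sigma i @^-1` A i)) =
        (\prod_(i <- J) Pr (sigma i @^-1` A i))%E].

(* The chain started at x.  The i.i.d. indices sigma^1, sigma^2, ... are
   numbered from 0, so that step N.+1 uses [sigma N]. *)
Fixpoint chain (Omega X : Type) (m : nat) (f : 'I_m -> X -> X)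
    (sigma : nat -> Omega -> 'I_m) (x : X) (N : nat) (w : Omega) : X :=
  if N is N'.+1 then f (sigma N' w) (chain f sigma x N' w) else x.

(* P(X^N \in A | X^0 = x): conditioning on X^0 = x, which may have
   probability 0, means starting the chain at x. *)
Definition transition_prob (R : realType) (d : measure_display)
    (Omega : measurableType d) (Pr : probability Omega R)
    (X : ptopologicalType) (m : nat) (f : 'I_m -> X -> X)
    (sigma : nat -> Omega -> 'I_m) (N : nat) (x : X) (A : set (borel X))
    : \bar R :=
  Pr [set w | A (chain f sigma x N w)].

(* Families of plain set functions, so that the transition probabilities need
   no bundled proof that they are probability measures. *)
Definition uniformly_tight (R : realType) (X : ptopologicalType)
    (M : set (set (borel X) -> \bar R)) : Prop :=
  forall eps : R, 0 < eps ->
    exists2 K : set X, compact K &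
      forall nu, M nu -> ((1 - eps)%:E <= nu K)%E.

(* Main.v *)
Require Import Defs.
From HB Require Import structures.
From mathcomp Require Import all_boot all_order all_algebra finmap.
From mathcomp Require Import all_classical all_reals all_analysis.
From mathcomp Require Import lra.
Set Implicit Arguments.
Unset Strict Implicit.
Unset Printing Implicit Defensive.
Import Order.TTheory GRing.Theory Num.Theory.
Import numFieldNormedType.Exports.
Local Open Scope classical_set_scope.
Local Open Scope ring_scope.

(** A Krylov-Bogolyubov argument that never passes through weak convergence.

    Let [p A N] be the probability that the chain started at [x] lies in [A] at
    time [N].  It is defined for every subset [A], Borel or not, because the
    chain takes finitely many values at each time, and the Markov property
    reads [p A N.+1 = \sum_j q j * p (f j @^-1` A) N] ([transition_rec]).
    Applying a Banach limit in [N] ([banach_limit], an ultrafilter limit of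
    Cesaro means) gives a finitely additive probability [lam] on all subsets
    of [X].  Shift invariance of the Banach limit turns the recursion into
    invariance, [lam A = \sum_j q j * lam (f j @^-1` A)], and tightness of the
    transition probabilities passes to [lam].

    It remains to trade finite for countable additivity.  The outer measure
    [open_outer lam] is the infimum of [\sum_n lam (G n)] over countable open
    covers [G].  Three facts make it the measure sought.
    - Open sets, hence Borel sets, are Caratheodory measurable
      ([open_caratheodory]): finite additivity of [lam] separates a closed
      subset of an open set [U] from the complement of [U], and [U] is
      exhausted by closed sets up to a small outer measure
      ([open_outer_approx]).
    - The total mass is [1] ([open_outer_setT]): no mass is lost, since an open
      cover of the space has a finite subcover on a compact set that carries
      almost all of [lam].
    - The dual operator does not increase it ([open_outer_dual_le]): the
      continuous maps [f j] pull an open cover of [A] back to open covers of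
      [f j @^-1` A], and the costs add up by invariance of [lam].
    The last inequality, applied to a Borel set and to its complement, is an
    equality because both sides are probability measures. *)

(** * Banach limits *)

Definition bounded_seq (R : realType) (u : R^nat) : Prop :=
  exists M, forall n, `|u n| <= M.

(** A cluster point exists by compactness of segments, and an ultrafilter
    decides every set, so it converges to each of its cluster points. *)
Lemma ultrafilter_bounded_cvg (R : realType) (U : set_system nat) (u : R^nat) :
  UltraFilter U -> bounded_seq u -> cvg (u @ U).
Proof.
move=> UU [M uM].
have UI : (u @ U) `[- M, M]%classic.
  by apply: nearW => n; rewrite /= in_itv/= -ler_norml.
have [p [_ clp]] := @segment_compact R (- M) M (u @ U) _ UI.
apply/cvg_ex; exists p => B Bp.
have [//|nB] := in_ultra_setVsetC (u @^-1` B) UU.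
by have [x [nBx Bx]] := clp (~` B) B nB Bp.
Qed.

Lemma arithmetic_meanE (R : realType) (u : R^nat) n :
  arithmetic_mean u n = n.+1%:R^-1 * \sum_(0 <= i < n.+1) u i.
Proof. by []. Qed.

Lemma arithmetic_mean_ge (R : realType) (u : R^nat) a :
  (forall n, a <= u n) -> forall n, a <= arithmetic_mean u n.
Proof.
move=> au n; rewrite arithmetic_meanE ler_pdivlMl// mulrC mulr_natr.
rewrite -[in leLHS](card_ord n.+1) -sumr_const big_mkord.
by apply: ler_sum => i _; exact: au.
Qed.

Lemma arithmetic_meanZ (R : realType) (u : R^nat) (c : R) :
  arithmetic_mean (fun n => c * u n) = (fun n => c * arithmetic_mean u n).
Proof.
by apply/funext => n; rewrite !arithmetic_meanE -mulr_sumr mulrCA.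
Qed.

Lemma arithmetic_meanD (R : realType) (u v : R^nat) :
  arithmetic_mean (fun n => u n + v n) =
  (fun n => arithmetic_mean u n + arithmetic_mean v n).
Proof.
by apply/funext => n; rewrite !arithmetic_meanE big_split/= mulrDr.
Qed.

Lemma bounded_arithmetic_mean (R : realType) (u : R^nat) :
  bounded_seq u -> bounded_seq (arithmetic_mean u).
Proof.
move=> [M uM]; exists M => n.
rewrite ler_norml arithmetic_mean_ge/=; last first.
  by move=> k; have := uM k; rewrite ler_norml => /andP[].
rewrite -lerN2 -[leRHS]mulN1r -[leRHS]/((fun n => _ * arithmetic_mean u n) n).
rewrite -arithmetic_meanZ arithmetic_mean_ge// => k.
by rewrite mulN1r lerN2 (le_trans (ler_norm _)).
Qed.

(** The difference telescopes to [(u n.+1 - u 0) / n.+1]: this is where the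
    averaging creates shift invariance. *)
Lemma arithmetic_mean_shift (R : realType) (u : R^nat) : bounded_seq u ->
  (fun n => arithmetic_mean (fun k => u k.+1) n - arithmetic_mean u n)
    @ \oo --> (0 : R).
Proof.
move=> [M uM]; apply/cvgr0Pnorm_le => e e0; near=> n.
rewrite !arithmetic_meanE -mulrBr -sumrB telescope_sumr// normrM.
rewrite ger0_norm// mulrC ler_pdivrMr//.
rewrite (@le_trans _ _ (M + M))//.
  by rewrite (le_trans (ler_normB _ _))// lerD.
rewrite -ler_pdivrMl//.
apply: (@le_trans _ _ n%:R); last by rewrite ler_nat.
by near: n; exact: nbhs_infty_ger.
Unshelve. all: by end_near. Qed.

(** An ultrafilter finer than [\oo] assigns a limit to the Cesaro means of
    every bounded sequence, and linearity and positivity pass to this limit.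
    Refining [\oo] ensures that the vanishing difference between the means of a
    sequence and of its shift has limit 0. *)
Lemma banach_limit (R : realType) : exists L : R^nat -> R,
  [/\ forall u v, bounded_seq u -> bounded_seq v ->
        L (fun n => u n + v n) = L u + L v,
      forall c u, bounded_seq u -> L (fun n => c * u n) = c * L u,
      forall u a, bounded_seq u -> (forall n, a <= u n) -> a <= L u,
      forall a, L (fun=> a) = a &
      forall u, bounded_seq u -> L (fun n => u n.+1) = L u].
Proof.
have [U [UU ooU]] := ultraFilterLemma (@eventually_filter : ProperFilter \oo).
pose L (u : R^nat) : R := lim (arithmetic_mean u @ U).
have Lcvg u : bounded_seq u -> arithmetic_mean u @ U --> L u.
  move=> bu; apply: ultrafilter_bounded_cvg => //.
  exact: bounded_arithmetic_mean.
have Leq u l : arithmetic_mean u @ U --> l -> L u = l by exact: cvg_lim.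
exists L; split.
- move=> u v bu bv; apply: Leq; rewrite arithmetic_meanD.
  by apply: cvgD; exact: Lcvg.
- move=> c u bu; apply: Leq; rewrite arithmetic_meanZ.
  by apply: cvgMr; exact: Lcvg.
- move=> u a bu au; apply: (cvgr_to_ge (Lcvg u bu)).
  by apply: nearW => n; exact: arithmetic_mean_ge.
- move=> a; apply: Leq; rewrite (_ : arithmetic_mean _ = fun=> a).
    exact: cvg_cst.
  apply/funext => n; rewrite arithmetic_meanE sumr_const_nat subn0.
  by rewrite -[a *+ _]mulr_natl mulKf.
- move=> u bu; apply: Leq.
  rewrite -[L u]add0r (_ : arithmetic_mean _ = fun n =>
    (arithmetic_mean (fun k => u k.+1) n - arithmetic_mean u n) +
    arithmetic_mean u n); last by apply/funext => n; rewrite subrK.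
  apply: cvgD; last exact: Lcvg.
  exact: cvg_trans (cvg_app _ ooU) (arithmetic_mean_shift bu).
Qed.

Lemma bounded_seqD (R : realType) (u v : R^nat) :
  bounded_seq u -> bounded_seq v -> bounded_seq (fun n => u n + v n).
Proof.
move=> [M uM] [N vN]; exists (M + N) => n.
by rewrite (le_trans (ler_normD _ _))// lerD.
Qed.

Lemma bounded_seqZ (R : realType) c (u : R^nat) :
  bounded_seq u -> bounded_seq (fun n => c * u n).
Proof. by move=> [M uM]; exists (`|c| * M) => n; rewrite normrM ler_wpM2l. Qed.

Lemma linear_bounded_seq_sum (R : realType) (L : R^nat -> R) (I : Type)
    (r : seq I) (c : I -> R) (u : I -> R^nat) :
  (forall u v, bounded_seq u -> bounded_seq v ->
    L (fun n => u n + v n) = L u + L v) ->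
  (forall c u, bounded_seq u -> L (fun n => c * u n) = c * L u) ->
  L (fun=> 0) = 0 -> (forall i, bounded_seq (u i)) ->
  L (fun n => \sum_(i <- r) c i * u i n) = \sum_(i <- r) c i * L (u i).
Proof.
move=> LD LZ L0 bu.
suff [] : bounded_seq (fun n => \sum_(i <- r) c i * u i n) /\
  L (fun n => \sum_(i <- r) c i * u i n) = \sum_(i <- r) c i * L (u i) by [].
elim: r => [|i r [br IH]].
  under [X in L X]eq_fun do rewrite big_nil.
  rewrite big_nil; split=> //; exists 0 => n.
  by rewrite big_nil normr0.
rewrite [X in L X](_ : _ = fun n => c i * u i n +
    \sum_(j <- r) c j * u j n); last by apply/funext => n; rewrite big_cons.
split; last by rewrite big_cons LD ?LZ ?IH//; exact: bounded_seqZ.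
rewrite [X in bounded_seq X](_ : _ = fun n => c i * u i n +
    \sum_(j <- r) c j * u j n); last by apply/funext => n; rewrite big_cons.
by apply: bounded_seqD => //; exact: bounded_seqZ.
Qed.

(** * The law of the chain *)

Lemma setI_preimage_ord (T : Type) (m : nat) (s : T -> 'I_m) (E : set T) :
  E = \big[setU/set0]_(j < m) (E `&` s @^-1` [set j]).
Proof.
rewrite -bigcup_seq; apply/seteqP; split=> [w Ew|w [j _ []//]].
by exists (s w) => //=; rewrite mem_index_enum.
Qed.

Lemma total_probability (R : realType) (d : measure_display)
    (Omega : measurableType d) (Pr : probability Omega R) (m : nat)
    (s : Omega -> 'I_m) (E : set Omega) :
  (forall j, measurable (s @^-1` [set j])) -> measurable E ->
  Pr E = (\sum_(j < m) Pr (E `&` s @^-1` [set j]))%E.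
Proof.
move=> ms mE; rewrite [in LHS](setI_preimage_ord s E) measure_bigsetU_ord//.
  by move=> j; exact: measurableI.
by move=> i j _ _ [w [[_ <-] [_ <-]]].
Qed.

Section transition.
Context (R : realType) (d : measure_display) (Omega : measurableType d).
Context (Pr : probability Omega R) (X : Type) (m : nat).
Context (f : 'I_m -> X -> X) (q : 'I_m -> R) (sigma : nat -> Omega -> 'I_m).
Context (x : X).
Hypothesis sigma_iid : iid_with_law Pr q sigma.

Local Notation hits N A := [set w | A (chain f sigma x N w)].

Lemma chain_step N (A : set X) j :
  hits N.+1 A `&` sigma N @^-1` [set j] =
  hits N (f j @^-1` A) `&` sigma N @^-1` [set j].
Proof. by apply/seteqP; split=> w [/= + sj]; rewrite sj. Qed.

(** This holds for every subset [A] of the state space: the chain is a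
    function of finitely many indices, each with finitely many values. *)
Lemma measurable_chain N (A : set X) : measurable (hits N A).
Proof.
have [sm _ _] := sigma_iid.
elim: N A => [|N IH] A.
  have [Ax|nAx] := pselect (A x).
    by rewrite (_ : hits _ _ = setT)//; apply/seteqP; split.
  by rewrite (_ : hits _ _ = set0)//; apply/seteqP; split.
rewrite (setI_preimage_ord (sigma N) (hits _ _)).
apply: bigsetU_measurable => j _; rewrite chain_step.
exact: measurableI.
Qed.

(** Only the index [N] is used below.  Allowing any finite set [J] of future
    indices makes the induction on [N] work: the step splits on the value of
    [sigma N] and moves this event into the future of time [N]. *)
Lemma chain_indep N (A : set X) (J : {fset nat}) (B : nat -> set 'I_m) :
  (forall i, i \in J -> (N <= i)%N) ->
  (Pr (hits N A `&` \bigcap_(i in [set` J]) (sigma i @^-1` B i)) =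
   Pr (hits N A) * Pr (\bigcap_(i in [set` J]) (sigma i @^-1` B i)))%E.
Proof.
have [sm sq sindep] := sigma_iid.
have sm' N' j : measurable (sigma N' @^-1` [set j]) by exact: sm.
have mJ (K : {fset nat}) B' :
    measurable (\bigcap_(i in [set` K]) (sigma i @^-1` B' i)).
  by apply: bigcap_measurableType => i _; exact: sm.
elim: N A J B => [|N IH] A J B NJ.
  have [Ax|nAx] := pselect (A x).
    rewrite (_ : hits _ _ = setT); last by apply/seteqP; split.
    by rewrite setTI probability_setT mul1e.
  rewrite (_ : hits _ _ = set0); last by apply/seteqP; split.
  by rewrite set0I measure0 mul0e.
have NnJ : N \notin J by apply/negP => /NJ; rewrite ltnn.
rewrite (total_probability Pr (sm' N))//; last first.
  by apply: measurableI => //; exact: measurable_chain.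
rewrite (@total_probability _ _ _ Pr _ _ (hits N.+1 A) (sm' N))//; last first.
  exact: measurable_chain.
rewrite ge0_sume_distrl; last by move=> *; exact: measure_ge0.
apply: eq_bigr => j _; rewrite setIAC chain_step -setIA.
(* With the event [sigma N = j] absorbed into the family of constraints, the
   induction hypothesis applies to the index set [N |` J]. *)
pose C j i := if i == N then [set j] else B i.
have CJ : \bigcap_(i in [set` J]) (sigma i @^-1` B i) =
          \bigcap_(i in [set` J]) (sigma i @^-1` C j i).
  apply: eq_bigcapr => i /= iJ; rewrite /C ifN//.
  by apply: contraNneq NnJ => <-.
have CN : sigma N @^-1` [set j] = sigma N @^-1` C j N by rewrite /C eqxx.
have sj : (Pr (hits N (f j @^-1` A) `&` sigma N @^-1` [set j]) =
    Pr (hits N (f j @^-1` A)) * Pr (sigma N @^-1` [set j]))%E.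
  have := IH (f j @^-1` A) [fset N]%fset (fun=> [set j]).
  by rewrite set_fset1 bigcap_set1; apply => i; rewrite inE => /eqP ->.
have CNJ : sigma N @^-1` C j N `&`
      \bigcap_(i in [set` J]) (sigma i @^-1` C j i) =
    \bigcap_(i in [set` (N |` J)%fset]) (sigma i @^-1` C j i).
  by rewrite bigcap_fsetU1.
rewrite sj CJ CN CNJ IH; last first.
  by move=> i; rewrite !inE => /predU1P[->//|/NJ/ltnW].
by rewrite !sindep big_fsetU1//= muleA.
Qed.

Lemma transition_rec N (A : set X) :
  (Pr (hits N.+1 A) = \sum_(j < m) (q j)%:E * Pr (hits N (f j @^-1` A)))%E.
Proof.
have [sm sq sindep] := sigma_iid.
have sm' N' j : measurable (sigma N' @^-1` [set j]) by exact: sm.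
rewrite (total_probability Pr (sm' N))//; last exact: measurable_chain.
apply: eq_bigr => j _; rewrite chain_step -(sq N j) muleC.
have := @chain_indep N (f j @^-1` A) [fset N]%fset (fun=> [set j]).
by rewrite set_fset1 bigcap_set1; apply => i; rewrite inE => /eqP ->.
Qed.

End transition.

(** * Exhaustion of open sets by closed sets *)

(** Witness: the points at distance at least [n.+1%:R^-1] from the complement
    of [U]. *)
Lemma open_exhaustion (R : realType) (X : metricType R) (U : set X) : open U ->
  exists C : (set X)^nat, [/\ forall n, closed (C n),
    forall n, C n `<=` (C n.+1)° & \bigcup_n C n = U].
Proof.
move=> oU.
pose C n := [set x : X | forall y, ~ U y -> n.+1%:R^-1 <= mdist x y :> R].
exists C; split.
- move=> n x clCx y nUy; rewrite leNgt; apply/negP => xy.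
  have r0 : 0 < n.+1%:R^-1 - mdist x y by rewrite subr_gt0.
  have [z [Cz]] := clCx _ (nbhsx_ballx x _ r0).
  rewrite ballEmdist/= ltrBrDr; apply/negP; rewrite -leNgt metric_sym.
  by rewrite (le_trans (Cz y nUy))// metric_triangle.
- move=> n x Cx; apply/nbhs_ballP; exists (n.+1%:R^-1 - n.+2%:R^-1) => /=.
    by rewrite subr_gt0 ltf_pV2 ?posrE// ltr_nat.
  move=> z; rewrite ballEmdist/= => xz y nUy.
  rewrite -(lerD2l (mdist x z)) (le_trans _ (metric_triangle x z y))//.
  by rewrite (le_trans _ (Cx y nUy))// -lerBrDr ltW.
- apply/seteqP; split=> [x [n _ Cx]|x Ux].
    apply: contrapT => /Cx; rewrite mdistxx; apply/negP.
    by rewrite -ltNge.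
  have [/= e e0 xeU] := (nbhs_ballP _ _).1 (open_nbhs_nbhs (conj oU Ux)).
  have [n ne] : exists n, n.+1%:R^-1 < e.
    near \oo => n; exists n; near: n.
    exact: (near_infty_natSinv_lt (PosNum e0)).
  exists n => // y nUy; rewrite (le_trans (ltW ne))// leNgt; apply/negP => xy.
  by apply/nUy/xeU; rewrite ballEmdist.
Unshelve. all: by end_near. Qed.

(** * Finitely additive probabilities *)

Definition finitely_additive_prob (R : realType) (X : Type) (lam : set X -> R)
    : Prop :=
  [/\ forall A, 0 <= lam A, lam setT = 1 &
      forall A B, A `&` B = set0 -> lam (A `|` B) = lam A + lam B].

Section finitely_additive.
Context (R : realType) (X : Type) (lam : set X -> R).
Hypothesis lamP : finitely_additive_prob lam.

Lemma fap_ge0 A : 0 <= lam A.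
Proof. by case: lamP. Qed.

Lemma fap_setD A B : A `<=` B -> lam (B `\` A) = lam B - lam A.
Proof.
have [_ _ lamU] := lamP => AB; apply/eqP; rewrite eq_sym subr_eq; apply/eqP.
rewrite -lamU; first by rewrite setDKU.
by rewrite setIC setDIK.
Qed.

Lemma fap0 : lam set0 = 0.
Proof. by rewrite -(setDv setT) fap_setD// subrr. Qed.

Lemma fap_le A B : A `<=` B -> lam A <= lam B.
Proof. by move=> AB; rewrite -subr_ge0 -fap_setD// fap_ge0. Qed.

Lemma fap_le1 A : lam A <= 1.
Proof. by have [_ <- _] := lamP; exact: fap_le. Qed.

Lemma fap_setU_le A B : lam (A `|` B) <= lam A + lam B.
Proof.
have [_ _ lamU] := lamP.
rewrite -(setDUK (@subsetUl _ A B)) lamU ?setDIK// lerD2l.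
by apply: fap_le; rewrite setDUD setDv set0U; exact: subDsetl.
Qed.

Lemma fap_bigsetU_le (A : (set X)^nat) n :
  lam (\big[setU/set0]_(i < n) A i) <= \sum_(i < n) lam (A i).
Proof.
elim: n => [|n IH]; first by rewrite !big_ord0 fap0.
by rewrite !big_ord_recr/= (le_trans (fap_setU_le _ _))// lerD2r.
Qed.

End finitely_additive.

(** * The outer measure given by open covers *)

Section open_outer.
Local Open Scope ereal_scope.
Context (R : realType) (X : ptopologicalType) (lam : set X -> R).

(** The value [+oo] on sets that are not open makes them useless in a cover, so
    that the infimum over covers by Borel sets in [mu_ext] is an infimum over
    covers by open sets. *)
Definition open_weight (A : set (borel X)) : \bar R :=
  if `[< open (A : set X) >] then (lam A)%:E else +oo.

Definition open_outer : set X -> \bar R := mu_ext open_weight.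

Hypothesis lamP : finitely_additive_prob lam.

Let open_weight_ge0 A : 0 <= open_weight A.
Proof.
by rewrite /open_weight; case: ifPn => _ //; rewrite lee_fin fap_ge0.
Qed.

Let open_weight_open (A : set X) : open A -> open_weight A = (lam A)%:E.
Proof. by move=> oA; rewrite /open_weight; case: asboolP. Qed.

Let open_weight0 : open_weight set0 = 0.
Proof. by rewrite open_weight_open ?fap0//; exact: open0. Qed.

Lemma open_outer_le_series A (G : (set X)^nat) : (forall n, open (G n)) ->
  A `<=` \bigcup_n G n -> open_outer A <= \sum_(n <oo) (lam (G n))%:E.
Proof.
move=> oG AG; apply: ereal_inf_lbound; exists G.
  by split=> // n; exact: sub_sigma_algebra.
by apply: eq_eseriesr => n _; rewrite open_weight_open.
Qed.

Lemma open_outer_glb A x :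
  (forall G : (set X)^nat, (forall n, open (G n)) -> A `<=` \bigcup_n G n ->
    x <= \sum_(n <oo) (lam (G n))%:E) ->
  x <= open_outer A.
Proof.
move=> xle; apply: le_ereal_inf_tmp => _ [G [_ AG] <-].
have [oG|/existsNP[n noG]] := pselect (forall n, open (G n : set X)).
  rewrite (eq_eseriesr (g := fun n => (lam (G n))%:E)).
    exact: xle.
  by move=> n _; rewrite open_weight_open.
rewrite (eseries_pinfty (k := n)) ?leey//.
  by move=> i _; rewrite -ltNye (lt_le_trans _ (open_weight_ge0 _)).
by rewrite /open_weight; case: asboolP.
Qed.

Lemma open_outer_le_open A G : open G -> A `<=` G ->
  open_outer A <= (lam G)%:E.
Proof.
move=> oG AG; pose F n := if n is 0%N then G else set0 : set X.
rewrite (_ : (lam G)%:E = \sum_(n <oo) (lam (F n))%:E).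
  apply: open_outer_le_series; first by case=> [//|n]; exact: open0.
  by move=> x /AG Gx; exists 0%N.
rewrite nneseries_recl//=; last by move=> n _; rewrite lee_fin fap_ge0.
rewrite eseries_cond/= eseries0 ?adde0// => -[//|n] _ _.
by rewrite /F fap0.
Qed.

Definition open_outer_measure : {outer_measure set X -> \bar R} :=
  HB.pack open_outer (isOuterMeasure.Build R X open_outer
    (mu_ext0 open_weight0 open_weight_ge0) (mu_ext_ge0 open_weight_ge0)
    (le_mu_ext open_weight) (mu_ext_sigma_subadditive open_weight_ge0)).

(** Compactness is what bounds the cost of a countable open cover from below:
    finite subadditivity of [lam] only controls finite covers. *)
Lemma open_outer_setT :
  (forall e : R, (0 < e)%R ->
    exists2 K : set X, compact K & (1 - e <= lam K)%R) ->
  open_outer setT = 1.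
Proof.
move=> tight; apply/eqP; rewrite eq_le; apply/andP; split.
  have [_ <- _] := lamP; apply: open_outer_le_open => //; exact: openT.
apply: open_outer_glb => G oG TG; apply/lee_addgt0Pr => e e0.
have [K + lamK] := tight e e0.
rewrite compact_cover => /(_ nat setT G (fun n _ => oG n)).
case=> [x _|D _ KD]; first exact: TG.
pose N := (\max_(i <- D) i).+1.
have KN : K `<=` \big[setU/set0]_(i < N) G i.
  rewrite -bigcup_mkord => x /KD[i /= iD Gix]; exists i => //=.
  by rewrite ltnS; exact: (@leq_bigmax_seq nat (enum_fset D) xpredT id i iD isT).
rewrite -leeBlDr// -EFinB; apply: (@le_trans _ _ (lam K)%:E) => //.
apply: (@le_trans _ _ (\sum_(i < N) (lam (G i))%:E)).
  rewrite sumEFin lee_fin (le_trans _ (fap_bigsetU_le lamP _ _))//.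
  exact: fap_le.
rewrite -(big_mkord xpredT (fun i => (lam (G i))%:E)).
by apply: nneseries_lim_ge => n _ _; rewrite lee_fin fap_ge0.
Qed.

(** Each open cover of [A] is pulled back to open covers of the preimages, and
    invariance of [lam] says that their weighted costs add up to the cost of
    the original cover. *)
Lemma open_outer_dual_le m (f : 'I_m -> X -> X) (q : 'I_m -> R) A :
  (forall j, continuous (f j)) -> (forall j, (0 <= q j)%R) ->
  (forall B, lam B = \sum_(j < m) q j * lam (f j @^-1` B))%R ->
  \sum_(j < m) (q j)%:E * open_outer (f j @^-1` A) <= open_outer A.
Proof.
move=> cf q0 lamf; apply: open_outer_glb => G oG AG.
rewrite [leRHS](_ : _ = \sum_(n <oo) \sum_(j < m) (q j)%:E *
    (lam (f j @^-1` G n))%:E); last first.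
  apply: eq_eseriesr => n _; rewrite lamf -sumEFin.
  by under eq_bigr do rewrite EFinM.
rewrite nneseries_sum; last first.
  by move=> j n _; rewrite mule_ge0// lee_fin// fap_ge0.
apply: lee_sum => j _; rewrite nneseriesZl; last first.
  by move=> n _; rewrite lee_fin fap_ge0.
rewrite lee_wpmul2l ?lee_fin//; apply: open_outer_le_series.
  by move=> n; apply: open_comp => // x _; exact: cf.
by rewrite -preimage_bigcup; exact: preimage_subset.
Qed.

End open_outer.

(** * Borel sets are measurable for the outer measure *)

Section metric_outer.
Local Open Scope ereal_scope.
Context (R : realType) (X : completeMetricType R) (lam : set X -> R).
Hypothesis lamP : finitely_additive_prob lam.
Local Notation mu := (open_outer_measure lamP).

(** Finite additivity does not give [lam (C n) --> lam U], so [U] has to be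
    covered at little more than the cost of some [C n].  The cover consists of
    the interior of [C n.+1] and of the overlapping open shells
    [(C k.+2)° `\` C k] for [k >= n]; their costs telescope and are at most
    twice the increase of [lam (C k)] after [n], which is small for large
    [n]. *)
Lemma open_outer_approx (U : set X) (C : (set X)^nat) (e : R) : (0 < e)%R ->
  (forall n, closed (C n)) -> (forall n, C n `<=` (C n.+1)°) ->
  \bigcup_n C n = U ->
  exists n, open_outer lam U <= (lam (C n) + e)%:E.
Proof.
move=> e0 cC CS CU.
pose F n := lam (C n).
have CSS n : C n `<=` C n.+1 by move=> x /CS /interior_subset.
have Fle1 n : (F n <= 1)%R by exact: fap_le1.
have FS n : (F n <= F n.+1)%R by exact: fap_le.
have supF : has_sup (range F).
  by split; [exists (F 0%N), 0%N|exists 1%R => _ [n _ <-]].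
have Fsup n : (F n <= sup (range F))%R.
  by apply: sup_upper_bound => //; exists n.
(* A third of [e]: the interior exceeds [F n] by at most [e / 3], the shells
   cost at most twice that. *)
have [_ [n _ <-]] := sup_adherent (divr_gt0 e0 (ltr0Sn R 2)) supF.
set L := sup (range F) => Ln; exists n.
pose G k := if k is k'.+1 then (C (n + k').+2)° `\` C (n + k')%N
            else (C n.+1)°.
have oG k : open (G k).
  case: k => [|k]; first exact: open_interior.
  by apply: openI; [exact: open_interior|exact: closed_openC].
have UG : U `<=` \bigcup_k G k.
  have CG k : C (n + k)%N `<=` \bigcup_k G k.
    elim: k => [|k IH] x; first by rewrite addn0 => /CS Gx; exists 0%N.
    rewrite addnS => Cx; have [/IH//|nCx] := pselect (C (n + k)%N x).
    by exists k.+1 => //; split => //; exact: CS.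
  rewrite -CU => x [k _ Ckx]; apply: (CG k).
  elim: (n) => [//|i Cikx]; rewrite addSn; exact: CSS.
apply: (le_trans (open_outer_le_series lam oG UG)).
apply: lime_le.
  by apply: is_cvg_nneseries => k _ _; rewrite lee_fin fap_ge0.
apply: nearW => N; rewrite sumEFin lee_fin.
have GS k : (lam (G k.+1) <= F (n + k).+2 - F (n + k)%N)%R.
  rewrite -fap_setD//; last by apply: subset_trans (CSS _); exact: CSS.
  apply: fap_le => //; apply: setSD; exact: interior_subset.
case: N => [|N]; first by rewrite big_geq// addr_ge0 ?fap_ge0// ltW.
rewrite big_nat_recl//.
have G0 : (lam (G 0%N) <= L)%R.
  rewrite (le_trans _ (Fsup n.+1))//; apply: fap_le => //.
  exact: interior_subset.
have : (\sum_(0 <= k < N) lam (G k.+1) <= 2 * (L - F n))%R.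
  (* Each shell spans two indices, hence the sum of two consecutive values. *)
  pose H k := (F (n + k).+1 + F (n + k)%N)%R.
  apply: (@le_trans _ _ (\sum_(0 <= k < N) (H k.+1 - H k))%R).
    apply: ler_sum => k _; rewrite (le_trans (GS k))// /H addnS; lra.
  rewrite telescope_sumr// /H addn0.
  have := Fsup (n + N).+1; have := Fsup (n + N)%N; have := FS n.
  rewrite -/L; lra.
have := Ln; rewrite -/(F n); lra.
Qed.

(** Closed subsets [C n] of [H `&` U] approximate it in outer measure, while
    [H `\` C n] is an open set containing [H `&` ~` U]; the weights of these two
    disjoint parts of [H] add up to [lam H]. *)
Lemma open_outer_split (H U : set X) : open H -> open U ->
  open_outer lam (H `&` U) + open_outer lam (H `&` ~` U) <= (lam H)%:E.
Proof.
move=> oH oU.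
have [C [cC CS CU]] := open_exhaustion (openI oH oU).
apply/lee_addgt0Pr => e e0.
have [n mun] := open_outer_approx e0 cC CS CU.
have CH : C n `<=` H.
  by move=> x Cx; have [] : (H `&` U) x by rewrite -CU; exists n.
apply: (le_trans (leeD mun (_ : _ <= (lam (H `\` C n))%:E))).
  apply: open_outer_le_open => //; first exact/openI/closed_openC.
  move=> x [Hx nUx]; split=> // Cx; apply: nUx.
  by have [] : (H `&` U) x by rewrite -CU; exists n.
by rewrite -!EFinD lee_fin fap_setD// addrC addrA subrK.
Qed.

Lemma open_caratheodory (U : set X) : open U -> mu.-caratheodory U.
Proof.
move=> oU; apply: le_caratheodory_measurable => A.
apply: open_outer_glb => // G oG AG.
apply: (@le_trans _ _ (\sum_(n <oo) (mu (G n `&` U) + mu (G n `&` ~` U)))).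
  rewrite nneseriesD; [|by move=> n _ _; exact: outer_measure_ge0..].
  apply: leeD.
    apply: (le_trans _ (outer_measure_sigma_subadditive mu _)).
    by apply: le_outer_measure; rewrite -setI_bigcupl; exact: setSI.
  apply: (le_trans _ (outer_measure_sigma_subadditive mu _)).
  by apply: le_outer_measure; rewrite -setI_bigcupl; exact: setSI.
apply: lee_nneseries => [n _ _|n _].
  by rewrite adde_ge0//; exact: outer_measure_ge0.
exact: open_outer_split.
Qed.

Lemma borel_caratheodory (A : set (borel X)) :
  measurable A -> mu.-caratheodory A.
Proof.
move: A; apply: smallest_sub; last exact: open_caratheodory.
exact: (@sigma_algebra_measurable _ (caratheodory_type mu)).
Qed.

Lemma open_outer_probability : open_outer lam setT = 1 ->
  exists nu : probability (borel X) R, forall A, nu A = open_outer lam A.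
Proof.
move=> mu1; pose nu : set (borel X) -> \bar R := mu.
have nuS : semi_sigma_additive nu.
  move=> F mF tF mUF.
  by apply: (@caratheodory_measure_sigma_additive _ _ mu) => // *;
    exact: borel_caratheodory.
pose nuM := isMeasure.Build _ _ _ nu
  (outer_measure0 mu) (outer_measure_ge0 mu) nuS.
pose nu1 : {measure set (borel X) -> \bar R} := HB.pack nu nuM.
pose nuP := Measure_isProbability.Build _ _ _ nu1 mu1.
pose nu' : probability (borel X) R := HB.pack (Measure.sort nu1) nuP.
by exists nu'.
Qed.

End metric_outer.

(** * Invariant probability measures *)

Lemma metric_lipschitz_continuous (R : realType) (X Y : metricType R)
    (f : X -> Y) : metric_lipschitz f -> continuous f.
Proof.
move=> [L L0 fL] x; apply/cvg_ballP => e e0.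
have L1 : 0 < L + 1 by rewrite ltr_wpDl.
apply/nbhs_ballP; exists (e / (L + 1)) => /=; first exact: divr_gt0.
move=> y; rewrite !ballEmdist/= ltr_pdivlMr// mulrC => xy.
rewrite (le_lt_trans _ xy)// (le_trans (fL x y))//.
by rewrite ler_wpM2r// ?lerDl// mdist_ge0.
Qed.

Lemma measurable_preimage_continuous (X Y : ptopologicalType) (f : X -> Y)
    (A : set Y) : continuous f ->
  measurable (A : set (borel Y)) -> measurable (f @^-1` A : set (borel X)).
Proof.
move=> cf mA; rewrite -[_ @^-1` _]setTI.
suff mf : measurable_fun setT (f : borel X -> borel Y) by exact: mf.
apply: (@measurability _ _ (borel X) (borel Y) setT f (@open Y)) => //.
move=> _ [U oU <-].
rewrite setTI; apply: sub_sigma_algebra; exact: open_comp.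
Qed.

Theorem theorem5p2 (R : realType) (X : completeMetricType R)
    (X_separable : separable X)
    (m : nat) (f : 'I_m -> X -> X)
    (f_lipschitz : forall j, metric_lipschitz (f j))
    (mu : nat -> 'I_m -> R) (mu_pmf : forall k, is_pmf (mu k))
    (P_feller : forall k, weak_feller (markov_op f (mu k)))
    (k : nat)
    (d : measure_display) (Omega : measurableType d)
    (Pr : probability Omega R) (sigma : nat -> Omega -> 'I_m)
    (sigma_iid : iid_with_law Pr (mu k) sigma)
    (tight : exists x : X,
      uniformly_tight (range (fun N => transition_prob Pr f sigma N x))) :
  exists nu : probability (borel X) R,
    forall A : set (borel X), measurable A -> markov_dual f (mu k) nu A = nu A.
Proof.
have [x tightx] := tight; have [q0 q1] := mu_pmf k.
have cf j : continuous (f j) by exact: metric_lipschitz_continuous.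
have [L [LD LZ Lge Lcst Lshift]] := banach_limit R.
pose p (A : set X) N := fine (Pr [set w | A (chain f sigma x N w)]).
have mp (A : set X) N : measurable [set w | A (chain f sigma x N w)].
  exact: measurable_chain sigma_iid _ _.
have pE (A : set X) N : (p A N)%:E = Pr [set w | A (chain f sigma x N w)].
  by rewrite fineK// fin_num_measure.
have p0 A N : 0 <= p A N by rewrite -lee_fin pE measure_ge0.
have p1 A N : p A N <= 1 by rewrite -lee_fin pE probability_le1.
have pb A : bounded_seq (p A).
  by exists 1 => n; rewrite ger0_norm.
have pS A N : p A N.+1 = \sum_(j < m) mu k j * p (f j @^-1` A) N.
  apply: EFin_inj; rewrite pE (transition_rec _ _ sigma_iid) -sumEFin.
  by apply: eq_bigr => j _; rewrite EFinM pE.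
pose lam A := L (p A).
have lamP : finitely_additive_prob lam.
  split.
  - by move=> A; exact: Lge.
  - rewrite /lam -[RHS]Lcst; congr L; apply/funext => n.
    by apply: EFin_inj; rewrite pE -(probability_setT Pr).
  - move=> A B AB0; rewrite /lam -LD//; congr L; apply/funext => n.
    apply: EFin_inj; rewrite EFinD !pE -measureU//.
    rewrite -subset0 => w ABw.
    by rewrite -[set0 w]/(set0 (chain f sigma x n w)) -AB0.
have lamS A : lam A = \sum_(j < m) mu k j * lam (f j @^-1` A).
  rewrite {1}/lam -Lshift//; under eq_fun do rewrite pS.
  exact: linear_bounded_seq_sum.
have lamtight e : 0 < e -> exists2 K : set X, compact K & 1 - e <= lam K.
  move=> /tightx[K cK nuK]; exists K => //; apply: (Lge _ _ (pb K)) => N.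
  rewrite -lee_fin pE.
  exact: (nuK (transition_prob Pr f sigma N x) (imageT _ N)).
have muT := open_outer_setT lamP lamtight.
have [nu nuE] := open_outer_probability lamP muT.
exists nu => A mA; apply/eqP; rewrite eq_le.
have dual_le (B : set (borel X)) : (markov_dual f (mu k) nu B <= nu B)%E.
  rewrite nuE; apply: le_trans (open_outer_dual_le lamP _ cf q0 lamS).
  by apply: lee_sum => j _; rewrite -nuE.
pose n (B : set (borel X)) := fine (nu B).
have nE B : measurable B -> nu B = (n B)%:E.
  by move=> mB; rewrite fineK// fin_num_measure.
have nC B : measurable B -> n (~` B) = 1 - n B.
  move=> mB; apply: EFin_inj.
  by rewrite EFinB -!nE ?probability_setC//; exact: measurableC.
have mf j B : measurable (B : set (borel X)) ->
    measurable (f j @^-1` B : set (borel X)).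
  exact: measurable_preimage_continuous.
have dualE B : measurable B ->
    markov_dual f (mu k) nu B = (\sum_(j < m) mu k j * n (f j @^-1` B))%:E.
  move=> mB; rewrite -sumEFin; apply: eq_bigr => j _.
  by rewrite EFinM -nE//; exact: mf.
have mAC := measurableC mA.
(* The reverse inequality is [dual_le] for the complement, by total mass 1. *)
rewrite dual_le/=; have := dual_le (~` A); rewrite !dualE// !nE// !lee_fin nC//.
have nfC j : n (f j @^-1` ~` A) = 1 - n (f j @^-1` A).
  by rewrite -nC//; exact: mf.
under eq_bigr do rewrite nfC mulrBr mulr1.
by rewrite sumrB q1 lerD2l lerN2.
Qed.
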